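(* Let $r$ be a positive integer, let $m_1\ge m_2\ge\dots\ge m_r$ be positive integers, and let $a=(m_1,\dots,m_r)$. Then the complete $r$-partite hypergraph $\mathcal H_r(a)$ satisfies $$\omega_0(\mathcal H_r(a))=m_r+\frac12\sum_{q=1}^r (m_q-1)\prod_{s=1}^q m_s .$$ In particular, for positive integers $p\ge q$, the complete bipartite graph $K_{p,q}$ satisfies $$\omega_0(K_{p,q})=\frac{2q+p\,(p-1+q(q-1))}{2}.$$
   Context: Let $A_1,\dots,A_r$ be pairwise disjoint sets with $|A_i|=m_i$. The complete $r$-partite hypergraph $\mathcal H_r(a)$ has vertex set $\bigcup_{i=1}^r A_i$ and hyperedge set $A_1\times\dots\times A_r$, where a tuple $(x_1,\dots,x_r)$ is identified with the set $\{x_1,\dots,x_r\}$. Graphs are regarded as hypergraphs whose hyperedges are their edges. An edge-discriminator on a hypergraph $\mathcal H=(\mathcal V,\mathcal E)$ is a function $\lambda:\mathcal V\to\mathbb Z^{+}\cup\{0\}$ such that $\sum_{v\in E}\lambda(v)>0$ for every $E\in\mathcal E$, and $\sum_{v\in E}\lambda(v)\ne\sum_{v\in E'}\lambda(v)$ for every two distinct $E,E'\in\mathcal E$. Its weight is $\omega_\lambda(\mathcal V)=\sum_{v\in\mathcal V}\lambda(v)$. The quantity $\omega_0(\mathcal H)$ is the minimum of $\omega_\lambda(\mathcal V)$ over all edge-discriminators $\lambda$ on $\mathcal H$. *)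

(* Defs.v *)
From HB Require Import structures.
From mathcomp Require Import all_boot all_order all_algebra.
From mathcomp Require Import boolp.

Set Implicit Arguments.
Unset Strict Implicit.
Unset Printing Implicit Defensive.

(* The vertex set is a finite set inside an ambient finite type, so that
   "pairwise disjoint sets A_1, ..., A_r" can be taken literally.  Hyperedges
   are nonempty: a hypergraph with an empty hyperedge has no
   edge-discriminator, hence no minimum weight. *)
Record hypergraph (T : finType) := Hypergraph {
  vertices : {set T};
  hyperedges : {set {set T}};
  hyperedges_sub : {in hyperedges, forall E : {set T}, E \subset vertices};
  hyperedges_neq0 : set0 \notin hyperedges }.

Record simple_graph (T : finType) := SimpleGraph {
  graph_vertices : {set T};
  graph_edges : {set {set T}};
  graph_edges_sub :
    {in graph_edges, forall E : {set T}, E \subset graph_vertices};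
  graph_edges_card : {in graph_edges, forall E : {set T}, #|E| = 2} }.

Lemma graph_edges_neq0 (T : finType) (G : simple_graph T) :
  set0 \notin graph_edges G.
Proof. by apply/negP => /graph_edges_card; rewrite cards0. Qed.

Coercion hypergraph_of_graph (T : finType) (G : simple_graph T) :
    hypergraph T :=
  Hypergraph (@graph_edges_sub T G) (graph_edges_neq0 G).

(* The values of [lam] outside [vertices H] play no role. *)
Definition edge_discriminator (T : finType) (H : hypergraph T)
    (lam : T -> nat) : Prop :=
  (forall E, E \in hyperedges H -> 0 < \sum_(v in E) lam v) /\
  (forall E E', E \in hyperedges H -> E' \in hyperedges H -> E != E' ->
     \sum_(v in E) lam v != \sum_(v in E') lam v).

Definition weight (T : finType) (H : hypergraph T) (lam : T -> nat) : nat :=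
  \sum_(v in vertices H) lam v.

Definition discriminator_weight (T : finType) (H : hypergraph T) : pred nat :=
  fun w => `[< exists2 lam, edge_discriminator H lam & weight H lam = w >].

Lemma binary_inj n (b c : nat -> bool) :
  \sum_(i < n) b i * 2 ^ i = \sum_(i < n) c i * 2 ^ i ->
  forall i, i < n -> b i = c i.
Proof.
elim: n b c => [//|n IHn] b c; rewrite !big_ord_recl /= !muln1.
have shift (d : nat -> bool) : \sum_(i < n) d (bump 0 i) * 2 ^ bump 0 i =
    (\sum_(i < n) d i.+1 * 2 ^ i).*2.
  rewrite -mul2n big_distrr; apply: eq_bigr => i _.
  by rewrite /bump leq0n add1n expnS mulnCA.
rewrite !shift => eq_bc.
have eq0 : b 0 = c 0.
  by move/(congr1 odd): eq_bc; rewrite !oddD !odd_double !addbF !oddb.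
move: eq_bc; rewrite eq0 => /addnI/double_inj eq_bc [//|i lt_in].
exact: (IHn (fun j => b j.+1) (fun j => c j.+1)).
Qed.

(* Giving the vertices distinct powers of 2 as labels works. *)
Lemma discriminator_weight_ex (T : finType) (H : hypergraph T) :
  exists w, discriminator_weight H w.
Proof.
pose lam (v : T) := 2 ^ enum_rank v.
exists (weight H lam); apply/asboolP; exists lam => //; split=> [E HE|E E' _ _].
  have [v vE] : exists v, v \in E.
    by apply/set0Pn; apply: contraNneq (hyperedges_neq0 H) => <-.
  by rewrite (bigD1 v) //= addn_gt0 expn_gt0.
apply: contraNneq => eqS; apply/eqP/setP => v.
pose bit (F : {set T}) i := [exists x in F, enum_rank x == i :> nat].
have bitE (F : {set T}) (x : T) : bit F (enum_rank x) = (x \in F).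
  apply/exists_inP/idP => [[y yF /eqP/val_inj/enum_rank_inj <-] //|xF].
  by exists x.
have sumE (F : {set T}) : \sum_(x in F) lam x = \sum_(i < #|T|) bit F i * 2 ^ i.
  rewrite (reindex (@enum_rank T)) /=; last first.
    by apply: onW_bij; apply: enum_rank_bij.
  rewrite big_mkcond; apply: eq_bigr => x _; rewrite bitE.
  by case: (x \in F); rewrite ?mul1n ?mul0n.
rewrite -!bitE; apply: (@binary_inj #|T|); last exact: ltn_ord.
by rewrite -!sumE.
Qed.

Definition omega0 (T : finType) (H : hypergraph T) : nat :=
  ex_minn (discriminator_weight_ex H).

(* Hyperedges are the ranges {x_1, ..., x_r} of the tuples x in
   A_1 x ... x A_r, where [x \in family A] says that [x i \in A i] for all i. *)
Definition partite_edges (T : finType) (r : nat) (A : 'I_r -> {set T}) :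
    {set {set T}} :=
  [set [set x i | i : 'I_r] | x : {ffun 'I_r -> T} in family A].

Lemma partite_edges_sub (T : finType) (r : nat) (A : 'I_r -> {set T}) :
  {in partite_edges A, forall E : {set T}, E \subset \bigcup_i A i}.
Proof.
move=> E /imsetP[x /familyP xA ->]; apply/subsetP => v /imsetP[i _ ->].
by apply/bigcupP; exists i => //; apply: xA.
Qed.

Lemma partite_edges_neq0 (T : finType) (r : nat) (A : 'I_r.+1 -> {set T}) :
  set0 \notin partite_edges A.
Proof.
apply/imsetP => -[x _ /setP/(_ (x ord0))]; rewrite inE => /esym/negP[].
exact: imset_f.
Qed.

Definition complete_partite (T : finType) (r : nat) (A : 'I_r.+1 -> {set T}) :
    hypergraph T :=
  Hypergraph (@partite_edges_sub T r.+1 A) (partite_edges_neq0 A).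

Definition bipartite_edges (T : finType) (A B : {set T}) : {set {set T}} :=
  [set [set x; y] | x in A, y in B].

Lemma bipartite_edges_sub (T : finType) (A B : {set T}) :
  {in bipartite_edges A B, forall E : {set T}, E \subset A :|: B}.
Proof.
move=> E /imset2P[x y xA yB ->]; apply/subsetP => v.
by rewrite !inE => /orP[] /eqP->; rewrite ?xA ?yB ?orbT.
Qed.

Lemma bipartite_edges_card (T : finType) (A B : {set T}) :
  [disjoint A & B] ->
  {in bipartite_edges A B, forall E : {set T}, #|E| = 2}.
Proof.
move=> dAB E /imset2P[x y xA yB ->]; rewrite cards2.
suff -> : x != y by [].
by apply: contraTneq yB => <-; rewrite (disjointFr dAB xA).
Qed.

Definition complete_bipartite (T : finType) (A B : {set T})
    (dAB : [disjoint A & B]) : simple_graph T :=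
  SimpleGraph (@bipartite_edges_sub T A B) (bipartite_edges_card dAB).

(* Main.v *)
Require Import Defs.
From HB Require Import structures.
From mathcomp Require Import all_boot all_order all_algebra.
From mathcomp Require Import boolp.
From mathcomp Require Import ring.

Set Implicit Arguments.
Unset Strict Implicit.
Unset Printing Implicit Defensive.

Import Order.TTheory GRing.Theory Num.Theory.
Local Open Scope ring_scope.

(** Upper bound: number the vertices of each part from 0 and label a vertex with its number times
    the product of the sizes of the earlier parts, adding 1 on the last part. An edge sum is then 1
    plus a mixed-radix numeral whose digits are the numbers of its vertices, so the sums are
    positive and distinct; the weight is the stated value ([mixed_radix_discriminator],
    [weight_mixed_radix]).

    Lower bound: let S_i be the total label of part i and P_k the product of the sizes of the first
    k parts. Fixing one vertex in each part after the k-th leaves P_k edges whose sums over the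
    first k parts are distinct naturals, so their average, the sum of S_i / m_i over i up to k, is
    at least (P_k - 1) / 2; for the last k positivity adds 1 ([prefix_avg_ge]). The weight is the
    sum of m_i times S_i / m_i. Since the m_i decrease, Abel summation ([abel_ge0]) turns these
    prefix inequalities into the bound on the weight ([weight_ge]), with the mixed-radix labels
    attaining each of them. *)

(** * Distinct integers, averages over products, Abel summation *)

Lemma leq_sum_uniq (c : nat) (s : seq nat) : uniq s -> all (leq c) s ->
  (\sum_(i < size s) (c + i) <= \sum_(x <- s) x)%N.
Proof.
move=> s_uniq s_ge; rewrite -(perm_big _ (permEl (perm_sort leq s))) /=.
rewrite -(size_sort leq).
have: sorted ltn (sort leq s).
  by rewrite ltn_sorted_uniq_leq sort_uniq s_uniq sort_sorted //; apply: leq_total.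
have: all (leq c) (sort leq s) by rewrite all_sort.
elim: (sort leq s) c {s_ge} => [|x t IHt] c /=; first by rewrite big_ord0.
case/andP=> le_cx _ x_t; rewrite big_ord_recl big_cons addn0 leq_add //.
have lt_t : all (ltn x) t by apply: order_path_min x_t; apply: ltn_trans.
apply: leq_trans (IHt c.+1 _ (path_sorted x_t)).
  by apply: leq_sum => i _; rewrite addSnnS.
by apply: sub_all lt_t => y; apply: leq_ltn_trans.
Qed.

Lemma sum_ord_ratE (n : nat) : (\sum_(i < n) i)%N%:R = n%:R * (n%:R - 1) / 2 :> rat.
Proof.
elim: n => [|n IHn]; first by rewrite big_ord0 !mul0r.
by rewrite big_ord_recr natrD IHn -natr1; field.
Qed.

Lemma sum_inj_ge (X : finType) (D : {set X}) (f : X -> nat) (c : nat) :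
    {in D &, injective f} -> {in D, forall x, (c <= f x)%N} ->
  #|D|%:R * (c%:R + (#|D|%:R - 1) / 2) <= (\sum_(x in D) f x)%N%:R :> rat.
Proof.
move=> f_inj f_ge.
have /leq_sum_uniq : uniq [seq f x | x in D].
  by rewrite map_inj_in_uniq ?enum_uniq // => x y; rewrite !mem_enum; apply: f_inj.
move/(_ c); rewrite size_map -cardE big_map big_enum /= => le_sum.
rewrite (_ : _ * _ = (\sum_(i < #|D|) (c + i))%N%:R).
  rewrite ler_nat; apply: le_sum.
  by apply/allP=> _ /mapP[x xD ->]; apply: f_ge; rewrite -mem_enum.
rewrite big_split sum_nat_const card_ord natrD natrM sum_ord_ratE mulrDr.
by rewrite mulrA.
Qed.

Lemma card_family_prod (I T : finType) (F : I -> {set T}) :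
  #|family F| = (\prod_i #|F i|)%N.
Proof. by rewrite card_family foldrE big_image. Qed.

(** Linearity of expectation: under the uniform law on the product, each coordinate is uniform on
    its own factor. *)
Lemma avg_family (I T : finType) (F : I -> {set T}) (g : I -> T -> nat) :
    (forall i, 0 < #|F i|)%N ->
  (\sum_(x in family F) \sum_i g i (x i))%N%:R / #|family F|%:R =
    \sum_i (\sum_(v in F i) g i v)%N%:R / #|F i|%:R :> rat.
Proof.
move=> F_gt0; rewrite exchange_big natr_sum mulr_suml; apply: eq_bigr => i _.
have -> : (\sum_(x in family F) g i (x i) =
           (\sum_(v in F i) g i v) * \prod_(j | j != i) #|F j|)%N.
  (* Padding [g i] with factors 1 makes the summand a product over all coordinates, so
     distributivity factors the sum over the family. *)
  pose h j v := if j == i then g i v else 1%N.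
  transitivity (\prod_j \sum_(v in F j) h j v)%N.
    rewrite (bigA_distr_big_dep (fun j v => v \in F j)).
    apply: eq_bigr => x _; rewrite (bigD1 i) //= /h eqxx big1 ?muln1 //.
    by move=> j /negPf->.
  rewrite (bigD1 i) //= /h eqxx; congr (_ * _)%N.
  by apply: eq_bigr => j /negPf->; rewrite sum1_card.
have -> : #|family F| = (#|F i| * \prod_(j | j != i) #|F j|)%N.
  by rewrite card_family_prod (bigD1 i).
rewrite !natrM invfM mulrACA divff ?mulr1 // pnatr_eq0 -lt0n.
by rewrite prodn_gt0.
Qed.

(** Abel summation: the sum is a combination of the partial sums of [d], whose coefficients are the
    drops [m i - m i.+1] and the final [m n]. *)
Lemma abel_ge0 (n : nat) (m d : nat -> rat) :
    (forall i, (i <= n)%N -> 0 <= m i) ->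
    (forall i, (i < n)%N -> m i.+1 <= m i) ->
    (forall k, (k <= n)%N -> 0 <= \sum_(i < k.+1) d i) ->
  0 <= \sum_(i < n.+1) m i * d i.
Proof.
move=> m_ge0 m_dec d_ge0.
suff le_sum k : (k <= n)%N ->
    m k * (\sum_(i < k.+1) d i) <= \sum_(i < k.+1) m i * d i.
  by apply: le_trans (le_sum n (leqnn n)); rewrite mulr_ge0 ?m_ge0 ?d_ge0.
elim: k => [_|k IHk lt_kn]; first by rewrite !big_ord1.
rewrite big_ord_recr [leRHS]big_ord_recr /= mulrDr lerD2r.
apply: le_trans (IHk (ltnW lt_kn)).
by rewrite ler_wpM2r ?m_dec // d_ge0 // ltnW.
Qed.

(** * Mixed-radix numerals *)

Lemma mixed_radix_lt (n : nat) (m a : nat -> nat) :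
    (forall i, i < n -> a i < m i)%N ->
  (\sum_(i < n) a i * \prod_(j < i) m j < \prod_(j < n) m j)%N.
Proof.
elim: n => [|n IHn] a_lt; first by rewrite !big_ord0.
rewrite !big_ord_recr /=.
apply: (@leq_trans (\prod_(j < n) m j + a n * \prod_(j < n) m j)%N).
  by rewrite ltn_add2r IHn // => i lt_in; rewrite a_lt // ltnW.
by rewrite -mulSn mulnC leq_mul2l a_lt ?orbT.
Qed.

Lemma mixed_radix_inj (n : nat) (m a b : nat -> nat) :
    (forall i, i < n -> a i < m i)%N -> (forall i, i < n -> b i < m i)%N ->
    (\sum_(i < n) a i * \prod_(j < i) m j)%N =
    (\sum_(i < n) b i * \prod_(j < i) m j)%N ->
  forall i, (i < n)%N -> a i = b i.
Proof.
elim: n => [//|n IHn] a_lt b_lt; rewrite !big_ord_recr /= => eq_ab.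
have a_lt' i : (i < n -> a i < m i)%N by move/ltnW; apply: a_lt.
have b_lt' i : (i < n -> b i < m i)%N by move/ltnW; apply: b_lt.
have lta := mixed_radix_lt a_lt'; have ltb := mixed_radix_lt b_lt'.
have P_gt0 := leq_ltn_trans (leq0n _) lta.
(* The lower digits sum to less than the top place value, so Euclidean division by it returns the
   top digit. *)
have eqn : a n = b n.
  move/(congr1 (fun s => s %/ \prod_(j < n) m j)%N): eq_ab.
  by rewrite !divnDMl // !divn_small.
move=> i; rewrite ltnS leq_eqVlt => /predU1P[->//|]; apply: IHn => //.
by move: eq_ab; rewrite eqn => /addIn.
Qed.

(** * General facts on the minimum weight *)

(** Lets the value pass between records that may differ in their proof fields, as for a bipartite
    graph and its two-part hypergraph. *)
Lemma omega0_eq (T : finType) (H H' : hypergraph T) :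
  vertices H = vertices H' -> hyperedges H = hyperedges H' ->
  omega0 H = omega0 H'.
Proof.
move=> eqV eqE; rewrite /omega0.
have eqw w : discriminator_weight H w = discriminator_weight H' w.
  by rewrite /discriminator_weight /edge_discriminator /weight eqV eqE.
case: ex_minnP => u Hu u_min; case: ex_minnP => v Hv v_min.
by apply/eqP; rewrite eqn_leq u_min ?eqw // v_min // -eqw.
Qed.

Lemma omega0_minimum (T : finType) (H : hypergraph T) (lam : T -> nat) :
    edge_discriminator H lam ->
    (forall mu, edge_discriminator H mu -> weight H lam <= weight H mu)%N ->
  omega0 H = weight H lam.
Proof.
move=> lamP lam_min; rewrite /omega0; case: ex_minnP => w /asboolP[mu muP <-] min_mu.
apply/eqP; rewrite eqn_leq lam_min // andbT.
by apply: min_mu; apply/asboolP; exists lam.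
Qed.

(** * Edges of a complete partite hypergraph as tuples *)

Section CompletePartite.

Variables (r : nat) (m : 'I_r.+1 -> nat).
Hypothesis m_gt0 : forall i : 'I_r.+1, (0 < m i)%N.
Variables (T : finType) (A : 'I_r.+1 -> {set T}).
Hypothesis A_disj : forall i j : 'I_r.+1, i != j -> [disjoint A i & A j].
Hypothesis A_card : forall i : 'I_r.+1, #|A i| = m i.

Lemma part_uniq i j v : v \in A i -> v \in A j -> i = j.
Proof.
move=> vi vj; apply/eqP; apply: contraLR vj => /A_disj/disjointFr->//.
Qed.

Lemma sum_edge (lam : T -> nat) (x : {ffun 'I_r.+1 -> T}) : x \in family A ->
  (\sum_(v in [set x i | i : 'I_r.+1]) lam v = \sum_i lam (x i))%N.
Proof.
move=> /familyP xA; rewrite big_imset //= => i j _ _ eq_x.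
by apply: (part_uniq (xA i)); rewrite eq_x.
Qed.

Lemma edge_inj (x y : {ffun 'I_r.+1 -> T}) : x \in family A -> y \in family A ->
  [set x i | i : 'I_r.+1] = [set y i | i : 'I_r.+1] -> x = y.
Proof.
move=> /familyP xA /familyP yA eq_xy; apply/ffunP => i.
have /imsetP[j _ xi] : x i \in [set y i | i : 'I_r.+1].
  by rewrite -eq_xy imset_f.
by rewrite xi (@part_uniq i j (y j)) // -xi.
Qed.

Lemma weight_partite (lam : T -> nat) :
  weight (complete_partite A) lam = (\sum_i \sum_(v in A i) lam v)%N.
Proof.
rewrite /weight /=.
by rewrite partition_disjoint_bigcup.
Qed.

(** Disjoint parts make a tuple recoverable from its range and its entries distinct, so sums over
    edges become coordinatewise sums over tuples. *)
Lemma edge_discriminator_partite (lam : T -> nat) :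
  edge_discriminator (complete_partite A) lam <->
  {in family A, forall x : {ffun 'I_r.+1 -> T}, 0 < \sum_i lam (x i)}%N /\
  {in family A &, injective (fun x : {ffun 'I_r.+1 -> T} => \sum_i lam (x i))%N}.
Proof.
split=> [[lam_gt0 lam_inj]|[lam_gt0 lam_inj]]; split.
- by move=> x xA; rewrite -sum_edge // lam_gt0 //= imset_f.
- move=> x y xA yA eq_xy; apply: edge_inj => //; apply/eqP.
  apply: contraTT isT => neq_xy.
  have /negP[] := lam_inj _ _ (imset_f _ xA) (imset_f _ yA) neq_xy.
  by rewrite !sum_edge // eq_xy.
- by move=> _ /imsetP[x xA ->]; rewrite sum_edge // lam_gt0.
- move=> _ _ /imsetP[x xA ->] /imsetP[y yA ->]; apply: contraNneq.
  by rewrite !sum_edge // => /lam_inj ->.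
Qed.

(** * Upper bound: the mixed-radix labels *)

(** The bound is strict so that [prefix_prod i] is the place value of part [i]; the product in the
    theorem is [prefix_prod i.+1]. *)
Definition prefix_prod (k : nat) : nat := (\prod_(s < r.+1 | (s < k)%N) m s)%N.

Lemma prefix_prodS (i : 'I_r.+1) :
  prefix_prod i.+1 = (m i * prefix_prod i)%N.
Proof.
rewrite /prefix_prod (bigD1 i) //=; congr (_ * _)%N; apply: eq_bigl => s.
by rewrite ltnS andbC -ltn_neqAle.
Qed.

Lemma prefix_prodE (k : nat) : (k <= r.+1)%N ->
  prefix_prod k = (\prod_(j < k) m (inord j))%N.
Proof.
move=> le_k; rewrite /prefix_prod (big_ord_widen _ (fun j => m (inord j)) le_k).
by apply: eq_bigr => s _; rewrite inord_val.
Qed.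

(** The sum has a single term when [v] lies in some part, which avoids choosing that part. The extra
    1 keeps edge sums positive; on the last, smallest part it costs least. *)
Definition mixed_radix_label (v : T) : nat :=
  (\sum_(i | v \in A i) (index v (enum (A i)) * prefix_prod i + (i == ord_max)))%N.

Lemma mixed_radix_labelE i v : v \in A i ->
  mixed_radix_label v = (index v (enum (A i)) * prefix_prod i + (i == ord_max))%N.
Proof.
move=> vA; rewrite /mixed_radix_label (bigD1 i) //= big1 ?addn0 // => j.
by case/andP=> /part_uniq/(_ vA)->; rewrite eqxx.
Qed.

Lemma mixed_radix_discriminator :
  edge_discriminator (complete_partite A) mixed_radix_label.
Proof.
apply/edge_discriminator_partite.
have sumE x : x \in family A -> (\sum_i mixed_radix_label (x i) =
    (\sum_i index (x i) (enum (A i)) * prefix_prod i).+1)%N.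
  move=> /familyP xA; rewrite (eq_bigr _ (fun i _ => mixed_radix_labelE (xA i))).
  rewrite big_split /= -[RHS]addn1; congr (_ + _)%N.
  by rewrite (bigD1 ord_max) //= eqxx big1 // => i /negPf->.
split=> [x xA|x y xA yA]; rewrite !sumE // => -[].
(* The numeral lemmas index digits by naturals; [inord] is faithful on the indices below [r.+1]. *)
pose digit (z : {ffun 'I_r.+1 -> T}) j := index (z (inord j)) (enum (A (inord j))).
have digitE (z : {ffun 'I_r.+1 -> T}) :
    (\sum_i index (z i) (enum (A i)) * prefix_prod i =
     \sum_(i < r.+1) digit z i * \prod_(j < i) m (inord j))%N.
  by apply: eq_bigr => i _; rewrite /digit inord_val prefix_prodE // ltnW.
have digit_lt z : z \in family A -> forall i, (i < r.+1 -> digit z i < m (inord i))%N.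
  by move=> /familyP zA i _; rewrite /digit -A_card cardE index_mem mem_enum zA.
rewrite !digitE => /(mixed_radix_inj (digit_lt x xA) (digit_lt y yA)) eq_xy.
apply/ffunP => i; have := eq_xy i (ltn_ord i); rewrite /digit inord_val.
by apply: (index_inj (x i)); rewrite mem_enum;
  [apply: (familyP xA) | apply: (familyP yA)].
Qed.

(** The digits of part [i] sum to m_i (m_i - 1) / 2, and m_i times the place value is
    [prefix_prod i.+1]. The extra 1 contributes the size of the last part. *)
Lemma weight_mixed_radix :
  (weight (complete_partite A) mixed_radix_label)%:R =
    (m ord_max)%:R + \sum_i ((m i)%:R - 1) * (prefix_prod i.+1)%:R / 2 :> rat.
Proof.
have sumE i : (\sum_(v in A i) mixed_radix_label v =
    (\sum_(j < m i) j) * prefix_prod i + (i == ord_max) * m i)%N.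
  rewrite (eq_bigr _ (fun v vA => mixed_radix_labelE vA)) big_split /=.
  rewrite sum_nat_const A_card mulnC -big_distrl /=; congr (_ * _ + _)%N.
  rewrite -big_enum /= -[in RHS]A_card cardE.
  case: (enum (A i)) (enum_uniq (mem (A i))) => [|v0 s] s_uniq.
    by rewrite big_nil big_ord0.
  rewrite (big_nth v0) big_mkord; apply: eq_bigr => j _.
  by rewrite index_uniq.
rewrite weight_partite (eq_bigr _ (fun i _ => sumE i)) big_split natrD addrC /=.
congr (_ + _).
  by rewrite (bigD1 ord_max) //= eqxx mul1n big1 ?addn0 // => i /negPf->; rewrite mul0n.
rewrite natr_sum; apply: eq_bigr => i _.
by rewrite prefix_prodS !natrM sum_ord_ratE; field.
Qed.

(** * Lower bound: prefix averages *)

Lemma prefix_avg_ge (lam : T -> nat) (k : 'I_r.+1) :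
    edge_discriminator (complete_partite A) lam ->
  ((prefix_prod k.+1)%:R - 1) / 2 + (k == ord_max)%:R <=
    \sum_(i < r.+1 | (i <= k)%N) (\sum_(v in A i) lam v)%N%:R / (m i)%:R :> rat.
Proof.
move=> /edge_discriminator_partite[lam_gt0 lam_inj].
have [a aA] : exists a : 'I_r.+1 -> T, forall i, a i \in A i.
  apply: (@fin_all_exists _ (fun=> T) (fun i v => v \in A i)) => i.
  by apply/set0Pn; rewrite -card_gt0 A_card.
                                                                              
pose F (i : 'I_r.+1) : {set T} := if (i <= k)%N then A i else [set a i].
pose g (i : 'I_r.+1) v := if (i <= k)%N then lam v else 0%N.
have F_gt0 i : (0 < #|F i|)%N.
  by rewrite /F; case: ifP; rewrite ?A_card ?cards1.
have FA x : x \in family F -> x \in family A.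
  move=> /familyP xF; apply/familyP => i; have := xF i; rewrite /F.
  by case: ifP => // _ /set1P->.
pose c := (\sum_(i < r.+1 | ~~ (i <= k)%N) lam (a i))%N.
have sumE x : x \in family F -> (\sum_i lam (x i) = \sum_i g i (x i) + c)%N.
  move=> /familyP xF; rewrite (bigID (fun i : 'I_r.+1 => i <= k)%N) /=.
  rewrite -big_mkcond; congr (_ + _)%N; apply: eq_bigr => i ik.
  by have := xF i; rewrite /F (negPf ik) => /set1P->.
have cardF : #|family F| = prefix_prod k.+1.
  rewrite card_family_prod /prefix_prod [RHS]big_mkcond; apply: eq_bigr => i _.
  by rewrite /F ltnS; case: ifP; rewrite ?A_card ?cards1.
have F_inj : {in [set x in family F] &,
    injective (fun x : {ffun 'I_r.+1 -> T} => \sum_i g i (x i))%N}.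
  move=> x y; rewrite !inE => xF yF eq_xy; apply: lam_inj; rewrite ?FA //.
  by rewrite !sumE // eq_xy.
have F_ge : {in [set x in family F], forall x : {ffun 'I_r.+1 -> T},
    (k == ord_max) <= \sum_i g i (x i)}%N.
  move=> x; rewrite inE => xF; case: eqP => // eqk; have := lam_gt0 x (FA x xF).
  (* For the last [k] nothing is frozen: [c] is an empty sum and the truncated sum is a full, hence
     positive, edge sum. *)
  rewrite sumE // [c]big1 ?addn0 // => i.
  by rewrite eqk /= -ltnS ltn_ord.
have P_gt0 : 0 < (prefix_prod k.+1)%:R :> rat by rewrite ltr0n prodn_gt0.
have := sum_inj_ge F_inj F_ge; rewrite cardsE cardF addrC -ler_pdivlMl // [leRHS]mulrC.
rewrite (eq_bigl (mem (family F))) => [|x]; last by rewrite inE.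
rewrite -cardF avg_family // => /le_trans; apply.
rewrite [leRHS]big_mkcond le_eqVlt; apply/orP; left; apply/eqP.
apply: eq_bigr => i _; rewrite /F /g; case: ifP => _; first by rewrite A_card.
by rewrite big1 ?mul0r.
Qed.

Hypothesis m_dec : forall i j : 'I_r.+1, (i <= j)%N -> (m j <= m i)%N.

Lemma weight_ge (lam : T -> nat) : edge_discriminator (complete_partite A) lam ->
  (m ord_max)%:R + \sum_i ((m i)%:R - 1) * (prefix_prod i.+1)%:R / 2 <=
    (weight (complete_partite A) lam)%:R :> rat.
Proof.
move=> lamP; rewrite weight_partite natr_sum -subr_ge0.
pose S i : rat := (\sum_(v in A i) lam v)%N%:R.
(* The subtracted terms are the increments in [k] of the bound in [prefix_avg_ge], so partial sums
   of [d] are the slacks there. Multiplied by m_i, they give the terms of the claimed weight,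
   because m_i [prefix_prod i] = [prefix_prod i.+1]. *)
pose d i : rat := S i / (m i)%:R -
  ((prefix_prod i.+1)%:R - (prefix_prod i)%:R) / 2 - (i == ord_max)%:R.
have -> : \sum_i S i -
    ((m ord_max)%:R + \sum_i ((m i)%:R - 1) * (prefix_prod i.+1)%:R / 2) =
    \sum_(i < r.+1) (m (inord i))%:R * d (inord i).
  have -> : (m ord_max)%:R = \sum_(i < r.+1) (m i)%:R * (i == ord_max)%:R :> rat.
    rewrite (bigD1 ord_max) //= eqxx mulr1 big1 ?addr0 // => i /negPf->.
    by rewrite mulr0.
  rewrite -big_split -sumrB; apply: eq_bigr => i _; rewrite inord_val /d prefix_prodS.
  by rewrite /= natrM; field; rewrite pnatr_eq0 -lt0n.
apply: (abel_ge0 (m := fun i => (m (inord i))%:R) (d := fun i => d (inord i))).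
- by move=> i _; apply: ler0n.
- by move=> i lt_ir; rewrite ler_nat m_dec // !inordK // ltnS ltnW.
move=> k le_kr; have := prefix_avg_ge (Ordinal (le_kr : (k < r.+1)%N)) lamP.
rewrite -subr_ge0 => /le_trans; apply.
have -> : \sum_(i < k.+1) d (inord i) = \sum_(i < r.+1 | (i < k.+1)%N) d i.
  rewrite (big_ord_widen _ (fun i => d (inord i)) (le_kr : (k < r.+1)%N)).
  by apply: eq_bigr => i _; rewrite inord_val.
rewrite le_eqVlt; apply/orP; left; apply/eqP.
rewrite /d !sumrB -addrA -opprD; congr (_ - (_ + _)).
  rewrite -mulr_suml; congr (_ / 2).
  (* The empty product [prefix_prod 0] is 1, the source of the -1 in the prefix bound. *)
  have := telescope_sumr (fun i => (prefix_prod i)%:R : rat) (leq0n k.+1).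
  rewrite /= [prefix_prod 0]big_pred0 // => <-; rewrite big_mkord.
  by rewrite (big_ord_widen _
    (fun i => (prefix_prod i.+1)%:R - (prefix_prod i)%:R)
    (le_kr : (k < r.+1)%N)).
rewrite -val_eqE /=.
rewrite (big_mkcond (fun i : 'I_r.+1 => (i < k.+1)%N)) (bigD1 ord_max) //= eqxx.
rewrite big1 ?addr0 => [|i /negPf->]; last by case: ifP.
by rewrite ltnS eqn_leq le_kr; case: ifP.
Qed.

Lemma omega0_complete_partite :
  (omega0 (complete_partite A))%:R =
    (m ord_max)%:R + \sum_i ((m i)%:R - 1) * (prefix_prod i.+1)%:R / 2 :> rat.
Proof.
rewrite (omega0_minimum mixed_radix_discriminator) ?weight_mixed_radix // => mu muP.
by rewrite -(ler_nat rat) weight_mixed_radix weight_ge.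
Qed.

End CompletePartite.

(** * The bipartite case and the final formulas *)

Lemma omega0_complete_bipartite (T : finType) (A B : {set T})
    (dAB : [disjoint A & B]) :
  omega0 (complete_bipartite dAB) =
  omega0 (complete_partite (fun i : 'I_2 => if i == ord0 then A else B)).
Proof.
apply: omega0_eq => /=; first by rewrite big_ord_recl big_ord1.
apply/setP => E; apply/imset2P/imsetP => [[x y xA yB ->]|[x /familyP xF ->]].
  exists [ffun i => if i == ord0 then x else y].
    by apply/familyP => i; rewrite ffunE; case: ifP.
  apply/setP => v; rewrite !inE; apply/idP/imsetP.
    case/orP=> /eqP->; [exists ord0 | exists ord_max] => //; by rewrite ffunE.
  by case=> i _ ->; rewrite ffunE; case: ifP; rewrite eqxx ?orbT.
exists (x ord0) (x ord_max); [exact: (xF ord0) | exact: (xF ord_max) |].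
apply/setP => v; rewrite !inE; apply/imsetP/idP.
  by case=> -[[|[|//]] lt_i] _ ->; apply/orP; [left | right];
    apply/eqP; congr (x _); apply: val_inj.
by case/orP=> /eqP->; [exists ord0 | exists ord_max].
Qed.

Theorem theorem1p4 :
  (forall (r : nat) (m : 'I_r.+1 -> nat)
     (m_gt0 : forall i : 'I_r.+1, (0 < m i)%N)
     (m_dec : forall i j : 'I_r.+1, (i <= j)%N -> (m j <= m i)%N)
     (T : finType) (A : 'I_r.+1 -> {set T})
     (A_disj : forall i j : 'I_r.+1, i != j -> [disjoint A i & A j])
     (A_card : forall i : 'I_r.+1, #|A i| = m i),
     (omega0 (complete_partite A))%:R =
       (m ord_max)%:R +
       2^-1 * (\sum_(q < r.+1)
                 ((m q)%:R - 1) * (\prod_(s < r.+1 | (s <= q)%N) (m s)%:R))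
       :> rat)
  /\
  (forall (p q : nat) (q_gt0 : (0 < q)%N) (le_qp : (q <= p)%N)
     (T : finType) (A B : {set T}) (dAB : [disjoint A & B])
     (A_card : #|A| = p) (B_card : #|B| = q),
     (omega0 (complete_bipartite dAB))%:R =
       (2 * q%:R + p%:R * (p%:R - 1 + q%:R * (q%:R - 1))) / 2 :> rat).
Proof.
split=> [r m m_gt0 m_dec T A A_disj A_card|p q q_gt0 le_qp T A B dAB A_card B_card].
  rewrite (omega0_complete_partite m_gt0 A_disj A_card m_dec) mulr_sumr.
  congr (_ + _); apply: eq_bigr => i _.
  by rewrite /prefix_prod natr_prod mulrC.
rewrite omega0_complete_bipartite.
(* The larger side [A] is part 0, so [le_qp] makes the sizes decreasing; the formula reads q + (p -
   1) p / 2 + (q - 1) p q / 2. *)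
rewrite (@omega0_complete_partite _ (fun i => if i == ord0 then p else q)).
- rewrite /prefix_prod !big_ord_recl big_ord0 /=.
  rewrite !(big_mkcond (fun s : 'I_2 => (s < _)%N)) /=.
  by rewrite !big_ord_recl !big_ord0 /= !natrM; field.
- by move=> i; case: ifP => // _; apply: leq_trans le_qp.
- move=> [[|[|//]] i_lt] [[|[|//]] j_lt] //= _.
  by rewrite disjoint_sym.
- by move=> i; case: ifP.
- by move=> [[|[|//]] i_lt] [[|[|//]] j_lt].
Qed.
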